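(* Given a bigerbe $B=(E,W,Y_1,Y_2)$ on $X$ (with trivialisations $M$ of $\delta_hE$ and $s$ of $\delta_vE$), there is a rigid bundle 2-gerbe $r_1(B)$ on $X$ using the cover $Y:=Y_1\to X$ and the semisimplicial space $Z_\bullet:=W^{[\bullet+1,1]}$ with $Z_k=W\times_{Y_2}\cdots\times_{Y_2}W$ ($k+1$ factors). The bundle $E\to Z_1\times_{Y_1^{[2]}}Z_1=W^{[2,2]}$ gives the bundle gerbe on $Y_1^{[2]}$, using the trivialisation $s$ as bundle gerbe multiplication, and the bundle 2-gerbe multiplication is given by the trivialisation $M$.
   Context: Work in the topological setting (compactly generated Hausdorff spaces, continuous maps and bundles), where a cover is a continuous map admitting local sections around every point of the codomain; (alternatively, in a category of manifolds with covers the surjective submersions). ''Bundle'' means principal $U(1)$-bundle and a trivialisation is a section. For a cover $Y\to X$, $Y^{[k]}$ is the $k$-fold fibre product, with face maps $d_i$ omitting the $(i+1)$-th factor. On a semisimplicial space, $\delta E=d_0^*E\otimes d_1^*E^*\otimes d_2^*E\otimes\cdots$, sections $s$ induce sections $\delta(s)$, and $\delta^2E$ is canonically trivial; a trivialisation of $\delta^2E$ is called trivial (written $1$, or $0$ additively) if it equals the canonical one. A bundle gerbe $(E,Y)$ on $X$ is a cover $Y\to X$, a bundle $E\to Y^{[2]}$ and a section $m$ of $\delta E\to Y^{[3]}$ with $\delta(m)=1$. A bigerbe $(E,W,Y_1,Y_2)$ on $X$ consists of a commutative square $W\to Y_2$, $W\to Y_1$, $Y_1\to X$, $Y_2\to X$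 that is locally split (all maps are covers, and so is $W\to Y_1\times_XY_2$); let $W^{[k,1]}=W\times_{Y_2}\cdots\times_{Y_2}W$ ($k$ factors), which lies over $Y_1^{[k]}$, and let $W^{[k,l]}$ be the $l$-fold fibre product of $W^{[k,1]}$ over $Y_1^{[k]}$, so $W^{[2,2]}=(W\times_{Y_2}W)^{[2]}$ over $Y_1\times_XY_1$; $\delta_h$ and $\delta_v$ are the operators $\delta$ in the first and second index. Further data: a bundle $E\to W^{[2,2]}$ and trivialisations $M$ of $\delta_hE$ and $s$ of $\delta_vE$ such that $\delta_hM$ and $\delta_vs$ are the canonical trivialisations and $\delta_vM=\delta_hs$ as trivialisations of the canonically isomorphic bundles $\delta_h\delta_vE\simeq\delta_v\delta_hE$. A (topological) rigid bundle 2-gerbe on $X$ consists of: (1) a cover $Y\to X$; (2) a 3-truncated semisimplicial space $Z_\bullet$ and a semisimplicial map $Z_\bullet\to Y^{[\bullet+1]}$ that is a cover in each degree; $Z_n^{[k]}$ is the $k$-fold fibre product of $Z_n$ over $Y^{[n+1]}$, with $\delta_h$, $\delta_v$ the operators $\delta$ for the maps $Z_n^{[k]}\to Z_{n-1}^{[k]}$, resp. $Z_n^{[k]}\to Z_n^{[k-1]}$; (3) a bundle $E\to Z_1^{[2]}$ and a section $m$ of $\delta_vE$ making $(E,Z_1)$ a bundle gerbe on $Y^{[2]}$; (4) a section $M$ of $\delta_hE\to Z_2^{[2]}$ (bundle 2-gerbe multiplication); (5) $\delta_v(M)=\delta_h(m)$ and $\delta_h(M)=1$. *)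

(* Defs.v *)
From HB Require Import structures.
From mathcomp Require Import all_boot all_order all_algebra.
From mathcomp Require Import complex.
From mathcomp Require Import all_classical all_reals.
From mathcomp Require Import topology normedtype.
From mathcomp Require Import zify.

Set Implicit Arguments.
Unset Strict Implicit.
Unset Printing Implicit Defensive.

Import Order.TTheory GRing.Theory Num.Theory.
Import numFieldNormedType.Exports.

Local Open Scope classical_set_scope.
Local Open Scope quotient_scope.
Local Open Scope ring_scope.


Section compactly_generated_spaces.

(* A meets every compact set K in a relatively open subset of K. *)
Definition kopen (T : topologicalType) (A : set T) :=
  forall K : set T, compact K -> exists2 U, open U & A `&` K = U `&` K.

Definition compactly_generated (T : topologicalType) :=
  forall A : set T, kopen A -> open A.

Lemma open_kopen (T : topologicalType) (A : set T) : open A -> kopen A.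
Proof. by move=> oA K _; exists A. Qed.

Section kification.
Variable T : topologicalType.

Lemma kopenT : kopen [set: T].
Proof. exact/open_kopen/openT. Qed.

Lemma kopenI : setI_closed (@kopen T).
Proof.
move=> A B kA kB K cK; have [U oU eU] := kA K cK; have [V oV eV] := kB K cK.
exists (U `&` V); first exact: openI.
by rewrite -(setIid K) setIACA eU eV setIACA.
Qed.

Lemma kopen_bigcup (I : Type) (f : I -> set T) :
  (forall i, kopen (f i)) -> kopen (\bigcup_i f i).
Proof.
move=> kf K cK.
have /choice[U oU] : forall i, exists U, open U /\ f i `&` K = U `&` K.
  by move=> i; have [U ? ?] := kf i K cK; exists U.
exists (\bigcup_i U i); first by apply: bigcup_open => i _; exact: (oU i).1.
rewrite !setI_bigcupl; apply: eq_bigcupr => i _; exact: (oU i).2.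
Qed.

(* T with the k-open sets as open sets; applied to a limit of topological
   spaces it gives the limit in compactly generated Hausdorff spaces. *)
Definition kification : Type := T.
HB.instance Definition _ := Choice.on kification.
HB.instance Definition _ :=
  isOpenTopological.Build kification kopenT kopenI kopen_bigcup.

Lemma kificationE (A : set kification) : open A = kopen (A : set T).
Proof. by []. Qed.

Lemma kification_continuous : continuous (id : kification -> T).
Proof. by apply/continuousP => A oA; rewrite kificationE; exact: open_kopen. Qed.

Lemma kification_compact (K : set T) :
  compact K -> compact (K : set kification).
Proof.
move=> cK F FF FK; have [x [Kx clx]] := cK F FF FK.
exists x; split => // A B FA; rewrite nbhsE => -[O [oO Ox] OB].
have [U oU OU] := oO K cK.
have Ux : U x by have [] : (U `&` K) x by rewrite -OU.
have [y [[Ay Ky] Uy]] := clx (A `&` K) U (filterI FA FK) (open_nbhs_nbhs (conj oU Ux)).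
exists y; split => //; apply: OB.
by have [] : (O `&` K) y by rewrite OU.
Qed.

Lemma kification_cg : compactly_generated kification.
Proof.
move=> A kA; rewrite kificationE => K cK.
have [U oU ->] := kA K (kification_compact cK).
have [V oV ->] := (oU : kopen (U : set T)) K cK.
by exists V.
Qed.

Lemma continuous_into_kification (S : topologicalType) (f : S -> T) :
  compactly_generated S -> continuous f -> continuous (f : S -> kification).
Proof.
move=> cgS cf; apply/continuousP => O; rewrite kificationE => kO.
apply: cgS => K cK.
have [U oU OU] := kO (f @` K) (continuous_compact (continuous_subspaceT cf) cK).
exists (f @^-1` U); first by move/continuousP : cf; exact.
apply/seteqP; split => x [fx Kx]; split => //.
  by have [] : (U `&` f @` K) (f x) by rewrite -OU; split => //; exists x.
by have [] : (O `&` f @` K) (f x) by rewrite OU; split => //; exists x.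
Qed.

End kification.
End compactly_generated_spaces.

Lemma hausdorff_inj (S T : topologicalType) (f : S -> T) :
  continuous f -> injective f -> hausdorff_space T -> hausdorff_space S.
Proof.
move=> cf fI hT p q clpq; apply: fI; apply: hT => A B nA nB.
have [x [? ?]] := clpq _ _ (cf p _ nA) (cf q _ nB).
by exists (f x).
Qed.

Definition set_elt (T : Type) (A : set T) (x : T) (Ax : A x) : A :=
  exist (fun x => x \in A) x (mem_set Ax).

Lemma subset_continuous_at (S T : topologicalType) (A : set T) (f : S -> A) x :
  {for x, continuous (set_val \o f : S -> T)} -> {for x, continuous f}.
Proof.
move=> cf U; rewrite nbhsE => -[_ [[V oV <-] Vx] VU].
have nV : nbhs x ((set_val \o f) @^-1` V).
  by apply: cf; exact: open_nbhs_nbhs.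
by apply: filterS nV => y; exact: VU.
Qed.

Lemma set_val_continuous (T : topologicalType) (A : set T) :
  continuous (set_val : A -> T).
Proof. exact: initial_continuous. Qed.

Lemma prod_continuous_at (S : topologicalType) (I : eqType)
    (T : I -> topologicalType) (f : S -> prod_topology T) x :
  (forall i, {for x, continuous (fun y => f y i)}) -> {for x, continuous f}.
Proof.
move=> cf; apply/cvg_sup => i U [_ [[V oV <-] Vx] VU].
have nV : nbhs x ((fun y => f y i) @^-1` V).
  by apply: cf; exact: open_nbhs_nbhs.
by apply: filterS nV => y; exact: VU.
Qed.

Lemma pair_continuous_at (S T U : topologicalType) (f : S -> T) (g : S -> U) x :
  {for x, continuous f} -> {for x, continuous g} ->
  {for x, continuous (fun y => (f y, g y))}.
Proof. by move=> cf cg; exact: cvg_pair. Qed.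

Lemma cst_continuous_at (S T : topologicalType) (t : T) (x : S) :
  {for x, continuous (fun=> t)}.
Proof. exact: cvg_cst. Qed.

Lemma eq_open_continuous_at (S T : topologicalType) (U : set S) (f g : S -> T) x :
  open U -> U x -> (forall y, U y -> f y = g y) ->
  {for x, continuous g} -> {for x, continuous f}.
Proof.
move=> oU Ux fg cg V; rewrite /= fg // => nV.
have nU : nbhs x U by exact: open_nbhs_nbhs.
have nW : nbhs x (g @^-1` V `&` U) by apply: filterI => //; exact: cg.
by apply: filterS nW => y [/= gy Uy]; rewrite /= fg.
Qed.

(* Compactly generated Hausdorff spaces. *)
Record cghType := CGH {
  cgh_space :> topologicalType ;
  cgh_hausdorff : hausdorff_space cgh_space ;
  cgh_cg : compactly_generated cgh_space }.

Section fibre_products.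

Definition fibre_product_set (Y1 Y2 X : cghType)
    (p1 : continuousType Y1 X) (p2 : continuousType Y2 X) : set (Y1 * Y2) :=
  [set y | p1 y.1 = p2 y.2].

Definition fibre_power_set k (Y X : cghType) (p : continuousType Y X) :
    set (prod_topology (fun _ : 'I_k => Y)) :=
  [set y | forall i j, p (y i) = p (y j)].
Arguments fibre_power_set k {Y X} p.

Section kified_subset.
Variables (T : topologicalType) (A : set T) (hT : hausdorff_space T).

Lemma kified_subset_hausdorff : hausdorff_space (kification A).
Proof.
apply: (@hausdorff_inj (kification A) A id (@kification_continuous A)) => //.
apply: (@hausdorff_inj _ T set_val _ val_inj) => //.
exact: set_val_continuous.
Qed.

Definition kified_subset := CGH kified_subset_hausdorff (@kification_cg A).
End kified_subset.
Arguments kified_subset {T} A hT.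

Lemma hausdorff_prod (S T : topologicalType) :
  hausdorff_space S -> hausdorff_space T -> hausdorff_space (S * T)%type.
Proof.
move=> hS hT [s t] [s' t'] cl; congr pair.
  apply: hS => A B nA nB; have [] := cl (fst @^-1` A) (fst @^-1` B).
  - exact: (cvg_fst nA).
  - exact: (cvg_fst nB).
  - by move=> x [? ?]; exists x.1.
apply: hT => A B nA nB; have [] := cl (snd @^-1` A) (snd @^-1` B).
- exact: (cvg_snd nA).
- exact: (cvg_snd nB).
- by move=> x [? ?]; exists x.2.
Qed.

Definition fibre_product (Y1 Y2 X : cghType) (p1 : continuousType Y1 X)
    (p2 : continuousType Y2 X) : cghType :=
  kified_subset (fibre_product_set p1 p2)
    (hausdorff_prod (@cgh_hausdorff Y1) (@cgh_hausdorff Y2)).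

(* The k-fold fibre product Y^[k] of Y over X, as functions on 'I_k. *)
Definition fibre_power k (Y X : cghType) (p : continuousType Y X) : cghType :=
  kified_subset (fibre_power_set k p)
    (hausdorff_product (fun _ : 'I_k => @cgh_hausdorff Y)).

Lemma continuous_into_kified_subset (S : cghType) (T : topologicalType)
    (A : set T) hT (f : S -> A) :
  continuous (set_val \o f : S -> T) ->
  continuous (f : S -> kified_subset A hT).
Proof.
move=> cf; apply: continuous_into_kification; first exact: cgh_cg.
by move=> x; apply/subset_continuous_at/cf.
Qed.

Lemma kified_subset_val_continuous (T : topologicalType) (A : set T) hT :
  continuous (set_val : kified_subset A hT -> T).
Proof.
move=> x; apply: (@continuous_comp (kification A) A T id set_val).
  exact: (@kification_continuous A).
exact: set_val_continuous.
Qed.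

Definition fibre_proj k (Y X : cghType) (p : continuousType Y X) (i : 'I_k)
  (y : fibre_power k p) : Y := set_val y i.

Lemma fibre_projP k (Y X : cghType) (p : continuousType Y X) (i j : 'I_k)
  (y : fibre_power k p) : p (fibre_proj i y) = p (fibre_proj j y).
Proof. exact: (set_mem (valP y)). Qed.

Lemma fibre_power_eq k (Y X : cghType) (p : continuousType Y X)
    (y y' : fibre_power k p) :
  (forall i, fibre_proj i y = fibre_proj i y') -> y = y'.
Proof. by move=> e; apply: val_inj; apply: functional_extensionality_dep. Qed.

Lemma fibre_proj_continuous k (Y X : cghType) (p : continuousType Y X)
  (i : 'I_k) : continuous (@fibre_proj k Y X p i).
Proof.
move=> x; apply: (@continuous_comp _ _ _
  (set_val : fibre_power k p -> prod_topology (fun _ : 'I_k => Y)) (proj i)).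
  exact: kified_subset_val_continuous.
exact: proj_continuous.
Qed.

Section fibre_tuple.
Variables (k : nat) (S Y X : cghType) (p : continuousType Y X).
Variables (f : 'I_k -> continuousType S Y).
Hypothesis fP : forall i j s, p (f i s) = p (f j s).

Definition fibre_tuple_fun (s : S) : fibre_power k p :=
  @set_elt _ (fibre_power_set k p) (fun i => f i s) (fun i j => fP i j s).

Lemma fibre_tuple_continuous : continuous fibre_tuple_fun.
Proof.
apply: continuous_into_kified_subset => s.
by apply: prod_continuous_at => i; exact: cts_fun.
Qed.

HB.instance Definition _ :=
  isContinuous.Build _ _ fibre_tuple_fun fibre_tuple_continuous.
Definition fibre_tuple : continuousType S (fibre_power k p) := fibre_tuple_fun.
End fibre_tuple.

End fibre_products.

Section circle_group.
Variable R : realType.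

Definition circle : set R[i]^o := [set z | `|z| = 1].

Definition U1 : topologicalType := circle.

Implicit Types g h : U1.

Definition u1val g : R[i]^o := set_val g.

Lemma u1valP g : `|u1val g| = 1.
Proof. exact: (set_mem (valP g)). Qed.

Lemma u1val_neq0 g : u1val g != 0.
Proof. by rewrite -normr_eq0 u1valP oner_eq0. Qed.

Lemma u1_eq g h : u1val g = u1val h -> g = h.
Proof. exact: val_inj. Qed.

Definition u1_one : U1 := @set_elt _ circle 1 (normr1 _).

Lemma u1_mul_subproof g h : circle (u1val g * u1val h).
Proof. by rewrite /circle/= normrM !u1valP mulr1. Qed.
Definition u1_mul g h : U1 := set_elt (u1_mul_subproof g h).

Lemma u1_inv_subproof g : circle (u1val g)^-1.
Proof. by rewrite /circle/= normfV u1valP invr1. Qed.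
Definition u1_inv g : U1 := set_elt (u1_inv_subproof g).

Lemma u1_mulA : associative u1_mul.
Proof. by move=> g h k; apply: u1_eq; exact: mulrA. Qed.
Lemma u1_mulC : commutative u1_mul.
Proof. by move=> g h; apply: u1_eq; exact: mulrC. Qed.
Lemma u1_mul1g : left_id u1_one u1_mul.
Proof. by move=> g; apply: u1_eq; exact: mul1r. Qed.
Lemma u1_mulg1 : right_id u1_one u1_mul.
Proof. by move=> g; rewrite u1_mulC u1_mul1g. Qed.
Lemma u1_mulVg : left_inverse u1_one u1_inv u1_mul.
Proof. by move=> g; apply: u1_eq; exact: mulVf (u1val_neq0 g). Qed.

HB.instance Definition _ :=
  Monoid.isComLaw.Build U1 u1_one u1_mul u1_mulA u1_mulC u1_mul1g.

Lemma u1_mulIg (k : U1) : injective (u1_mul^~ k).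
Proof.
by move=> g h /(congr1 (fun x => u1_mul x (u1_inv k)));
  rewrite -!u1_mulA [u1_mul k _]u1_mulC u1_mulVg !u1_mulg1.
Qed.

Lemma u1_invM g h : u1_inv (u1_mul g h) = u1_mul (u1_inv g) (u1_inv h).
Proof. by apply: u1_eq; exact: invfM. Qed.

Lemma u1_invK : involutive u1_inv.
Proof. by move=> g; apply: u1_eq; exact: invrK. Qed.

Lemma u1_inv1 : u1_inv u1_one = u1_one.
Proof. by apply: u1_eq; exact: invr1. Qed.

Lemma u1_mul_continuous : continuous (fun gh : U1 * U1 => u1_mul gh.1 gh.2).
Proof.
move=> gh; apply: subset_continuous_at.
apply: (@cvgM _ _ _ _ (fun gh : U1 * U1 => u1val gh.1)
  (fun gh : U1 * U1 => u1val gh.2)).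
  by apply: (continuous_comp (f := fst)); [exact: cvg_fst|exact: set_val_continuous].
by apply: (continuous_comp (f := snd)); [exact: cvg_snd|exact: set_val_continuous].
Qed.

Lemma u1_inv_continuous : continuous u1_inv.
Proof.
move=> g; apply: subset_continuous_at.
apply: (@cvgV _ _ (nbhs (g : U1)) _ u1val _ (u1val_neq0 g)).
exact: (@set_val_continuous _ circle g).
Qed.

Definition u1_sgn (b : bool) g : U1 := if b then u1_inv g else g.

Lemma u1_sgnM b g h : u1_sgn b (u1_mul g h) = u1_mul (u1_sgn b g) (u1_sgn b h).
Proof. by case: b; rewrite //= u1_invM. Qed.

Lemma u1_sgn1 b : u1_sgn b u1_one = u1_one.
Proof. by case: b; rewrite //= u1_inv1. Qed.

Lemma u1_sgn_sgn b c g : u1_sgn b (u1_sgn c g) = u1_sgn (b (+) c) g.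
Proof. by case: b c => -[] //=; rewrite u1_invK. Qed.

Lemma u1_sgnV b g : u1_mul (u1_sgn b g) (u1_sgn (~~ b) g) = u1_one.
Proof. by case: b; rewrite /= ?u1_mulVg // u1_mulC u1_mulVg. Qed.

Lemma u1_sgn_continuous b : continuous (u1_sgn b).
Proof. by case: b; [exact: u1_inv_continuous | move=> g; exact: cvg_id]. Qed.

Lemma u1_sgn_prod (I : finType) b (c : I -> U1) :
  u1_sgn b (\big[u1_mul/u1_one]_i c i) = \big[u1_mul/u1_one]_i u1_sgn b (c i).
Proof. exact: (big_morph (u1_sgn b) (u1_sgnM b) (u1_sgn1 b)). Qed.

Lemma u1_prod_continuous_at (T : topologicalType) n (f : 'I_n -> T -> U1) x :
  (forall i, {for x, continuous (f i)}) ->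
  {for x, continuous (fun y => \big[u1_mul/u1_one]_(i < n) f i y)}.
Proof.
elim: n f => [|n IH] f cf.
  rewrite (_ : (fun y => _) = fun=> u1_one); first exact: cvg_cst.
  by apply/funext => y; rewrite big_ord0.
rewrite (_ : (fun y => _) = fun y => u1_mul (f ord0 y)
   (\big[u1_mul/u1_one]_(i < n) f (lift ord0 i) y)); last first.
  by apply/funext => y; rewrite big_ord_recl.
have c2 := IH _ (fun i => cf (lift ord0 i)).
apply: (continuous_comp (g := fun gh : U1 * U1 => u1_mul gh.1 gh.2)
  (f := fun y => (f ord0 y, \big[u1_mul/u1_one]_(i < n) f (lift ord0 i) y))).
  exact: pair_continuous_at.
exact: u1_mul_continuous.
Qed.

End circle_group.
Arguments u1_one {R}.


Section bundles.
Variable R : realType.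
Local Notation U1 := (U1 R).

(* The map p |-> (proj p, tau p) is an equivariant homeomorphism from the part
   of P over the open set U to U * U(1), with inverse phi; the values of phi
   and tau outside these sets are irrelevant. *)
Record is_local_trivialisation (X P : topologicalType) (proj : P -> X)
    (act : U1 -> P -> P) (U : set X) (phi : X * U1 -> P) (tau : P -> U1) := {
  lt_open : open U ;
  lt_phi_continuous : {in U `*` setT, continuous phi} ;
  lt_tau_continuous : {in proj @^-1` U, continuous tau} ;
  lt_proj : forall x g, U x -> proj (phi (x, g)) = x ;
  lt_phiK : forall x g, U x -> tau (phi (x, g)) = g ;
  lt_tauK : forall p, U (proj p) -> phi (proj p, tau p) = p ;
  lt_act : forall g p, U (proj p) -> tau (act g p) = u1_mul g (tau p) }.

(* Principal U(1)-bundles.  Over a compactly generated Hausdorff base the total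
   space is again compactly generated Hausdorff, being locally a product with
   the compact group U(1).  For the same reason the constructions on bundles
   below use the ordinary product topology: it is already compactly
   generated. *)
Record bundle (X : topologicalType) := Bundle {
  total : topologicalType ;
  bproj : continuousType total X ;
  bact : U1 -> total -> total ;
  bact_continuous : continuous (fun gp : U1 * total => bact gp.1 gp.2) ;
  bact1 : forall p, bact u1_one p = p ;
  bactM : forall g h p, bact (u1_mul g h) p = bact g (bact h p) ;
  bproj_act : forall g p, bproj (bact g p) = bproj p ;
  bundle_locally_trivial : forall x, exists U phi tau,
    U x /\ is_local_trivialisation bproj bact U phi tau }.

(* A set-theoretic section, continuous or not. *)
Record pre_section (X : topologicalType) (E : bundle X) := PreSection {
  presec :> X -> total E ;
  presecP : forall x, bproj E (presec x) = x }.

(* Continuous sections, that is, trivialisations of E. *)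
Record bsection (X : topologicalType) (E : bundle X) := BSection {
  bsec :> continuousType X (total E) ;
  bsecP : forall x, bproj E (bsec x) = x }.

Definition pre_section_of (X : topologicalType) (E : bundle X)
  (s : bsection E) : pre_section E := PreSection (bsecP s).
Coercion pre_section_of : bsection >-> pre_section.

Section bundle_theory.
Variables (X : topologicalType) (E : bundle X).

Lemma bfibre_nonempty x : exists p, bproj E p = x.
Proof.
have [U [phi [tau [Ux lt]]]] := bundle_locally_trivial E x.
by exists (phi (x, u1_one)); rewrite (lt_proj lt).
Qed.

Definition point_section : pre_section E :=
  PreSection (fun x => projT2 (cid (bfibre_nonempty x))).

Definition local_section_spec x (U : set X) (sigma : pre_section E)
    (tau : total E -> U1) :=
  [/\ [/\ open U, U x, {in U, continuous sigma} &
        {in bproj E @^-1` U, continuous tau}],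
      forall y, U y -> tau (sigma y) = u1_one,
      forall p, U (bproj E p) -> bact (tau p) (sigma (bproj E p)) = p &
      forall g p, U (bproj E p) -> tau (bact g p) = u1_mul g (tau p)].

Lemma local_section x : exists U sigma tau, local_section_spec x U sigma tau.
Proof.
have [U [phi [tau [Ux lt]]]] := bundle_locally_trivial E x.
pose s y := if pselect (U y) then phi (y, u1_one) else point_section y.
have sP y : bproj E (s y) = y.
  by rewrite /s; case: pselect => Uy; [rewrite (lt_proj lt)|exact: presecP].
have sU y : U y -> s y = phi (y, u1_one) by rewrite /s; case: pselect.
exists U, (PreSection sP), tau; split => /=.
- split => //.
  + exact: lt_open lt.
  + move=> y /set_mem Uy.
    have c1 : {for y, continuous (fun z => phi (z, u1_one))}.
      apply: (continuous_comp (f := fun z => (z, u1_one)) (g := phi)).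
        by apply: pair_continuous_at; [exact: cvg_id|exact: cvg_cst].
      by apply: (lt_phi_continuous lt); apply/mem_set.
    exact: (eq_open_continuous_at (lt_open lt) Uy sU c1).
  + exact: lt_tau_continuous lt.
- by move=> y Uy; rewrite sU // (lt_phiK lt).
- move=> p Up; set q := bact _ _.
  have pq : bproj E q = bproj E p by rewrite bproj_act sP.
  have tq : tau q = tau p.
    by rewrite /q /= (lt_act lt) ?sP // sU // (lt_phiK lt) // u1_mulg1.
  by rewrite -(lt_tauK lt Up) -tq -pq (lt_tauK lt) // pq.
- exact: lt_act lt.
Qed.

Lemma bact_free g h p : bact g p = bact h p :> total E -> g = h.
Proof.
have [U [_ [tau [[_ Up _ _] _ _ tA]]]] := local_section (bproj E p).
by move=> /(congr1 tau); rewrite !tA // => /u1_mulIg.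
Qed.

Lemma bact_transitive p q : bproj E p = bproj E q -> exists g, q = bact g p.
Proof.
have [U [s [tau [[_ Up _ _] _ sK _]]]] := local_section (bproj E p) => pq.
exists (u1_mul (tau q) (u1_inv (tau p))).
rewrite -[X in bact _ X](sK p) // -bactM -u1_mulA u1_mulVg u1_mulg1.
by rewrite pq sK // -pq.
Qed.

End bundle_theory.

Lemma bundle_of_local_sections (X P : topologicalType) (proj : P -> X)
    (act : U1 -> P -> P) :
  continuous (fun gp : U1 * P => act gp.1 gp.2) ->
  (forall g p, proj (act g p) = proj p) ->
  forall x U (sigma : X -> P) (tau : P -> U1),
  (forall y, proj (sigma y) = y) ->
  [/\ [/\ open U, U x, {in U, continuous sigma} &
        {in proj @^-1` U, continuous tau}],
      forall y, U y -> tau (sigma y) = u1_one,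
      forall p, U (proj p) -> act (tau p) (sigma (proj p)) = p &
      forall g p, U (proj p) -> tau (act g p) = u1_mul g (tau p)] ->
  exists U phi tau, U x /\ is_local_trivialisation proj act U phi tau.
Proof.
move=> cact pact x U s tau sP [[oU Ux cs ct] ts sK tA].
exists U, (fun z => act z.2 (s z.1)), tau; split => //; split => //.
- move=> -[y g] /set_mem[/= Uy _].
  apply: (continuous_comp (f := fun z => (z.2, s z.1))
    (g := fun gp : U1 * P => act gp.1 gp.2)); last exact: cact.
  apply: pair_continuous_at; first exact: cvg_snd.
  by apply: (continuous_comp (f := fst)); [exact: cvg_fst|apply/cs/mem_set].
- by move=> y g Uy; rewrite pact sP.
- by move=> y g Uy; rewrite tA ?sP // ts // u1_mulg1.
Qed.

Section pullback.
Variables (A B : topologicalType) (f : continuousType A B) (E : bundle B).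

Definition pullback_set : set (A * total E) := [set p | bproj E p.2 = f p.1].

Definition pullback_total : topologicalType := pullback_set.

Definition pullback_point (a : A) (p : total E) (h : bproj E p = f a) :
    pullback_total :=
  @set_elt _ pullback_set (a, p) h.

Definition pullback_base (p : pullback_total) : A := (set_val p).1.
Definition pullback_fibre (p : pullback_total) : total E := (set_val p).2.

Lemma pullbackP p : bproj E (pullback_fibre p) = f (pullback_base p).
Proof. exact: (set_mem (valP p)). Qed.

Lemma pullback_eq p q : pullback_base p = pullback_base q ->
  pullback_fibre p = pullback_fibre q -> p = q.
Proof.
move=> e1 e2; apply: val_inj; change (set_val p = set_val q).
by rewrite [LHS]surjective_pairing [RHS]surjective_pairing; congr pair.
Qed.

Lemma pullback_base_continuous : continuous pullback_base.
Proof.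
move=> p; apply: (continuous_comp (f := set_val) (g := fst)).
  exact: set_val_continuous.
exact: cvg_fst.
Qed.

Lemma pullback_fibre_continuous : continuous pullback_fibre.
Proof.
move=> p; apply: (continuous_comp (f := set_val) (g := snd)).
  exact: set_val_continuous.
exact: cvg_snd.
Qed.

HB.instance Definition _ :=
  isContinuous.Build _ _ pullback_base pullback_base_continuous.

Lemma pullback_act_subproof g p :
  bproj E (bact g (pullback_fibre p)) = f (pullback_base p).
Proof. by rewrite bproj_act pullbackP. Qed.

Definition pullback_act g p : pullback_total :=
  pullback_point (pullback_act_subproof g p).

Lemma pullback_point_continuous_at (S : topologicalType) (a : S -> A)
    (p : S -> total E) (h : forall s, bproj E (p s) = f (a s)) s :
  {for s, continuous a} -> {for s, continuous p} ->
  {for s, continuous (fun s => pullback_point (h s))}.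
Proof.
by move=> ca cp; apply: subset_continuous_at; exact: pair_continuous_at.
Qed.

Lemma pullback_act1 p : pullback_act u1_one p = p.
Proof. by apply: pullback_eq => //; exact: bact1. Qed.

Lemma pullback_actM g h p :
  pullback_act (u1_mul g h) p = pullback_act g (pullback_act h p).
Proof. by apply: pullback_eq => //; exact: bactM. Qed.

Lemma pullback_act_continuous :
  continuous (fun gp : U1 * pullback_total => pullback_act gp.1 gp.2).
Proof.
move=> gp; apply: (@pullback_point_continuous_at (U1 * pullback_total)%type
  (fun gp => pullback_base gp.2) (fun gp => bact gp.1 (pullback_fibre gp.2))
  (fun gp => pullback_act_subproof gp.1 gp.2)).
  apply: (continuous_comp (f := snd)); first exact: cvg_snd.
  exact: pullback_base_continuous.
apply: (continuous_comp (f := fun gp => (gp.1, pullback_fibre gp.2))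
  (g := fun gp => bact gp.1 gp.2)); last exact: bact_continuous.
apply: pair_continuous_at; first exact: cvg_fst.
apply: (continuous_comp (f := snd)); first exact: cvg_snd.
exact: pullback_fibre_continuous.
Qed.

Lemma pullback_locally_trivial (a : A) : exists U phi tau,
  U a /\ is_local_trivialisation pullback_base pullback_act U phi tau.
Proof.
have [U [s [tau [[oU Ua cs ct] ts sK tA]]]] := local_section E (f a).
apply: (@bundle_of_local_sections _ _ pullback_base pullback_act
  pullback_act_continuous _ a (f @^-1` U)
  (fun a => pullback_point (presecP s (f a))) (tau \o pullback_fibre)) => //.
split.
- split => //.
  + by move: (@cts_fun _ _ f) => /continuousP; exact.
  + move=> b /set_mem /= Ub; apply: (@pullback_point_continuous_at _ id
      (fun a => s (f a)) (fun a => presecP s (f a))).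
      exact: cvg_id.
    by apply: continuous_comp; [exact: cts_fun|exact/cs/mem_set].
  + move=> p /set_mem /= Up; apply: continuous_comp.
      exact: pullback_fibre_continuous.
    by apply: ct; apply/mem_set; rewrite /= pullbackP.
- by move=> b /= Ub; exact: ts.
- move=> p /= Up; apply: pullback_eq => //=.
  change (bact (tau (pullback_fibre p)) (s (f (pullback_base p))) =
    pullback_fibre p).
  by rewrite -pullbackP sK // pullbackP.
- by move=> g p /= Up; rewrite tA // pullbackP.
Qed.

Definition pullback : bundle A :=
  @Bundle A pullback_total pullback_base pullback_act pullback_act_continuous
    pullback_act1 pullback_actM (fun g p => erefl) pullback_locally_trivial.

End pullback.

(* E itself if b is false, and the dual of E (same total space, inverse
   action) if b is true. *)
Section dual.
Variables (X : topologicalType) (b : bool) (E : bundle X).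

Definition dual_act (g : U1) (p : total E) : total E := bact (u1_sgn b g) p.

Lemma dual_act_continuous :
  continuous (fun gp : U1 * total E => dual_act gp.1 gp.2).
Proof.
move=> gp; apply: (continuous_comp (f := fun gp => (u1_sgn b gp.1, gp.2))
  (g := fun gp => bact gp.1 gp.2)); last exact: bact_continuous.
apply: pair_continuous_at; last exact: cvg_snd.
apply: (continuous_comp (f := fst)); first exact: cvg_fst.
exact: u1_sgn_continuous.
Qed.

Lemma dual_act1 p : dual_act u1_one p = p.
Proof. by rewrite /dual_act u1_sgn1 bact1. Qed.

Lemma dual_actM g h p : dual_act (u1_mul g h) p = dual_act g (dual_act h p).
Proof. by rewrite /dual_act u1_sgnM bactM. Qed.

Lemma dual_proj_act g p : bproj E (dual_act g p) = bproj E p.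
Proof. exact: bproj_act. Qed.

Lemma dual_locally_trivial x : exists U phi tau,
  U x /\ is_local_trivialisation (bproj E) dual_act U phi tau.
Proof.
have [U [s [tau [[oU Ua cs ct] ts sK tA]]]] := local_section E x.
apply: (@bundle_of_local_sections _ _ (bproj E) dual_act dual_act_continuous
  dual_proj_act x U s (u1_sgn b \o tau)); first exact: presecP.
split.
- split => // p Up; apply: continuous_comp; first exact: ct.
  exact: u1_sgn_continuous.
- by move=> y Uy; rewrite /= ts // u1_sgn1.
- by move=> p Up; rewrite /dual_act/= u1_sgn_sgn addbb sK.
- by move=> g p Up; rewrite /= tA // u1_sgnM u1_sgn_sgn addbb.
Qed.

Definition dual_if : bundle X :=
  @Bundle X (total E) (bproj E) dual_act dual_act_continuous dual_act1
    dual_actM dual_proj_act dual_locally_trivial.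

End dual.

(* The tensor product of E_0, ..., E_n is the quotient of their fibre product
   by the action of the tuples (c_0, ..., c_n) with c_0 * ... * c_n = 1; U(1)
   acts on it through any one factor, here the factor 0. *)
Section tensor.
Variables (X : topologicalType) (n : nat) (E : 'I_n.+1 -> bundle X).
Implicit Types c : 'I_n.+1 -> U1.

Definition tensor_set : set (prod_topology (fun i => total (E i))) :=
  [set p | forall i j, bproj (E i) (p i) = bproj (E j) (p j)].

Definition tensor_pre : topologicalType := tensor_set.
Implicit Types p q : tensor_pre.

Definition tcomp p i : total (E i) := set_val p i.

Lemma tcompP p i j : bproj (E i) (tcomp p i) = bproj (E j) (tcomp p j).
Proof. exact: (set_mem (valP p)). Qed.

Lemma tensor_pre_eq p q : (forall i, tcomp p i = tcomp q i) -> p = q.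
Proof. by move=> e; apply: val_inj; apply: functional_extensionality_dep. Qed.

Lemma tcomp_continuous i : continuous (tcomp^~ i).
Proof.
move=> p; apply: (@continuous_comp _ _ _
  (set_val : tensor_pre -> prod_topology (fun i => total (E i)))
  (@proj _ (fun i => total (E i) : Type) i)).
  exact: set_val_continuous.
exact: proj_continuous.
Qed.

Lemma tensor_act_subproof c p i j :
  bproj (E i) (bact (c i) (tcomp p i)) = bproj (E j) (bact (c j) (tcomp p j)).
Proof. by rewrite !bproj_act; exact: tcompP. Qed.

Definition tensor_pre_act c p : tensor_pre :=
  @set_elt _ tensor_set (fun i => bact (c i) (tcomp p i))
    (tensor_act_subproof c p).

Lemma tensor_pre_act_comp c d p :
  tensor_pre_act c (tensor_pre_act d p) =
  tensor_pre_act (fun i => u1_mul (c i) (d i)) p.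
Proof. by apply: tensor_pre_eq => i; exact/esym/bactM. Qed.

Lemma tensor_pre_act1 p : tensor_pre_act (fun=> u1_one) p = p.
Proof. by apply: tensor_pre_eq => i; exact: bact1. Qed.

Definition tensor_rel p q : bool :=
  `[< exists c, \big[@u1_mul R/u1_one]_i c i = u1_one /\ q = tensor_pre_act c p >].

Lemma tensor_rel_refl : reflexive tensor_rel.
Proof.
move=> p; apply/asboolP; exists (fun=> u1_one).
by rewrite big1 // tensor_pre_act1.
Qed.

Lemma tensor_rel_sym : symmetric tensor_rel.
Proof.
suff h p q : tensor_rel p q -> tensor_rel q p.
  by move=> p q; apply/idP/idP; exact: h.
move=> /asboolP[c [c1 ->]]; apply/asboolP; exists (fun i => u1_inv (c i)); split.
  by rewrite -(u1_sgn_prod true) c1 /= u1_inv1.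
rewrite tensor_pre_act_comp -[LHS]tensor_pre_act1; congr tensor_pre_act.
by apply/funext => i; rewrite u1_mulVg.
Qed.

Lemma tensor_rel_trans : transitive tensor_rel.
Proof.
move=> q p r /asboolP[c [c1 ->]] /asboolP[d [d1 ->]]; apply/asboolP.
exists (fun i => u1_mul (d i) (c i)); split; last exact: tensor_pre_act_comp.
by rewrite big_split /= c1 d1 u1_mul1g.
Qed.

Definition tensor_equiv :=
  EquivRel tensor_rel tensor_rel_refl tensor_rel_sym tensor_rel_trans.

Definition tensor_total : topologicalType :=
  quotient_topology {eq_quot tensor_equiv}.

Definition tensor_class p : tensor_total := \pi_{eq_quot tensor_equiv} p.

Definition tensor_repr (u : tensor_total) : tensor_pre :=
  repr (u : {eq_quot tensor_equiv}).

Lemma tensor_reprK u : tensor_class (tensor_repr u) = u.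
Proof. exact: reprK. Qed.

Lemma tensor_classP p q : tensor_class p = tensor_class q <->
  exists c, \big[@u1_mul R/u1_one]_i c i = u1_one /\ q = tensor_pre_act c p.
Proof.
split=> [h|h].
  by apply/asboolP; have /eqmodP := h.
by apply/eqmodP; apply/asboolP.
Qed.

Lemma tensor_class_act c p : \big[@u1_mul R/u1_one]_i c i = u1_one ->
  tensor_class (tensor_pre_act c p) = tensor_class p.
Proof. by move=> c1; apply/esym/tensor_classP; exists c. Qed.

Lemma tensor_repr_class p : exists c,
  \big[@u1_mul R/u1_one]_i c i = u1_one /\
  tensor_repr (tensor_class p) = tensor_pre_act c p.
Proof. by apply/tensor_classP; rewrite tensor_reprK. Qed.

Lemma tensor_class_continuous : continuous tensor_class.
Proof. by apply/continuousP => A oA; exact: oA. Qed.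

Lemma tensor_pre_act_continuous c : continuous (tensor_pre_act c).
Proof.
move=> p; apply: subset_continuous_at; apply: prod_continuous_at => i.
apply: (continuous_comp (f := fun p => (c i, tcomp p i))
  (g := fun gp => bact gp.1 gp.2)); last exact: bact_continuous.
by apply: pair_continuous_at; [exact: cst_continuous_at|exact: tcomp_continuous].
Qed.

Lemma tensor_class_open (O : set tensor_pre) : open O ->
  open (tensor_class @` O).
Proof.
move=> oO.
have -> : open (tensor_class @` O) =
    open (tensor_class @^-1` (tensor_class @` O)) by [].
rewrite (_ : _ @^-1` _ = \bigcup_(c in
  [set c | \big[@u1_mul R/u1_one]_i c i = u1_one]) tensor_pre_act c @^-1` O).
  apply: bigcup_open => c _.
  by have /continuousP := @tensor_pre_act_continuous c; exact.
apply/seteqP; split => p /=.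
  by move=> [q Oq /esym/tensor_classP[c [c1 qE]]]; exists c; rewrite //= -qE.
by move=> [c c1 Oc]; exists (tensor_pre_act c p) => //; exact: tensor_class_act.
Qed.

Lemma tensor_continuous_at (T : topologicalType) (f : tensor_total -> T) p :
  {for p, continuous (f \o tensor_class)} ->
  {for tensor_class p, continuous f}.
Proof.
move=> cf V nV; have : nbhs p ((f \o tensor_class) @^-1` V) by exact: cf.
rewrite nbhsE => -[O [oO Op] OV]; rewrite nbhs_simpl nbhsE.
exists (tensor_class @` O); last by move=> _ [q Oq <-]; exact: OV.
by split; [exact: tensor_class_open|exists p].
Qed.

Definition tensor_proj (u : tensor_total) : X :=
  bproj (E ord0) (tcomp (tensor_repr u) ord0).

Lemma tensor_proj_class p i : tensor_proj (tensor_class p) = bproj (E i) (tcomp p i).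
Proof.
have [c [_ e]] := tensor_repr_class p.
by rewrite /tensor_proj e bproj_act; exact: tcompP.
Qed.

Lemma tensor_proj_continuous : continuous tensor_proj.
Proof.
move=> u; rewrite -(tensor_reprK u); apply: tensor_continuous_at.
rewrite (_ : _ \o _ = fun p => bproj (E ord0) (tcomp p ord0)).
  apply: continuous_comp; first exact: tcomp_continuous.
  exact: cts_fun.
by apply/funext => p; exact: tensor_proj_class.
Qed.

HB.instance Definition _ :=
  isContinuous.Build _ _ tensor_proj tensor_proj_continuous.

Definition at0 (g : U1) (i : 'I_n.+1) : U1 := if i == ord0 then g else u1_one.

Lemma prod_at0 g : \big[@u1_mul R/u1_one]_i at0 g i = g.
Proof.
rewrite big_ord_recl /at0 /= big1 ?u1_mulg1 // => i _.
Qed.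

Definition tensor_act (g : U1) (u : tensor_total) : tensor_total :=
  tensor_class (tensor_pre_act (at0 g) (tensor_repr u)).

Lemma tensor_act_class c g p : \big[@u1_mul R/u1_one]_i c i = g ->
  tensor_class (tensor_pre_act c p) = tensor_act g (tensor_class p).
Proof.
move=> cg; rewrite /tensor_act; have [d [d1 ->]] := tensor_repr_class p.
rewrite tensor_pre_act_comp; apply/tensor_classP.
exists (fun i => u1_mul (u1_mul (at0 g i) (d i)) (u1_inv (c i))); split.
  rewrite !big_split /= prod_at0 d1 -(u1_sgn_prod true) cg /= u1_mulg1.
  by rewrite u1_mulC u1_mulVg.
rewrite tensor_pre_act_comp; congr tensor_pre_act; apply/funext => i.
by rewrite -u1_mulA u1_mulVg u1_mulg1.
Qed.

Lemma tensor_act1 u : tensor_act u1_one u = u.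
Proof.
rewrite -(tensor_reprK u) -(@tensor_act_class (fun=> u1_one)) ?big1 //.
by rewrite tensor_pre_act1.
Qed.

Lemma tensor_actM g h u :
  tensor_act (u1_mul g h) u = tensor_act g (tensor_act h u).
Proof.
rewrite -(tensor_reprK u) -!(tensor_act_class _ (prod_at0 _)).
rewrite tensor_pre_act_comp [LHS](tensor_act_class _ (prod_at0 _)); apply: esym.
by apply: tensor_act_class; rewrite big_split /= !prod_at0.
Qed.

Lemma tensor_proj_act g u : tensor_proj (tensor_act g u) = tensor_proj u.
Proof.
rewrite -(tensor_reprK u) -(tensor_act_class _ (prod_at0 _)).
by rewrite !(tensor_proj_class _ ord0) bproj_act.
Qed.

Lemma tensor_act_continuous :
  continuous (fun gu : U1 * tensor_total => tensor_act gu.1 gu.2).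
Proof.
move=> [g u] V /=; rewrite -(tensor_reprK u); set p := tensor_repr u => nV.
have cf : {for (g, p), continuous (fun gp : U1 * tensor_pre =>
    tensor_class (tensor_pre_act (at0 gp.1) gp.2))}.
  apply: continuous_comp; last exact: tensor_class_continuous.
  apply: subset_continuous_at; apply: prod_continuous_at => i.
  apply: (continuous_comp (f := fun gp => (at0 gp.1 i, tcomp gp.2 i))
    (g := fun gp => bact gp.1 gp.2)); last exact: bact_continuous.
  apply: pair_continuous_at.
    by rewrite /at0; case: eqP => _; [exact: cvg_fst|exact: cst_continuous_at].
  apply: (continuous_comp (f := snd) (g := tcomp^~ i)); first exact: cvg_snd.
  exact: tcomp_continuous.
have [] := cf V; first by rewrite /= (tensor_act_class _ (prod_at0 _)).
move=> [A B] [/= nA nB] AB.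
move: nB; rewrite nbhsE => -[O [oO Op] OB].
have nO : nbhs (tensor_class p) (tensor_class @` O).
  apply: open_nbhs_nbhs; split; first exact: tensor_class_open.
  by exists p.
exists (A, tensor_class @` O); first by split.
move=> [h _] [/= Ah [q Oq <-]].
have /= := AB (h, q); rewrite (tensor_act_class _ (prod_at0 h)); apply.
by split => //; exact: OB.
Qed.

Definition tensor_point (x : X) (p : forall i, total (E i))
    (h : forall i, bproj (E i) (p i) = x) : tensor_total :=
  tensor_class (@set_elt _ tensor_set p (fun i j => etrans (h i) (esym (h j)))).

Lemma tensor_point_proj x (p : forall i, total (E i)) (h : forall i, bproj (E i) (p i) = x) :
  tensor_proj (tensor_point h) = x.
Proof. by rewrite (tensor_proj_class _ ord0); exact: h. Qed.

Lemma tensor_point_act x (p q : forall i, total (E i)) (hp : forall i, bproj (E i) (p i) = x)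
    (hq : forall i, bproj (E i) (q i) = x) c g :
  (forall i, q i = bact (c i) (p i)) -> \big[@u1_mul R/u1_one]_i c i = g ->
  tensor_point hq = tensor_act g (tensor_point hp).
Proof.
move=> qE cg; rewrite -(tensor_act_class _ cg); congr tensor_class.
by apply: tensor_pre_eq => i; exact: qE.
Qed.

Lemma tensor_point_continuous_at (S : topologicalType) (x : S -> X)
    (p : forall i, S -> total (E i))
    (h : forall s i, bproj (E i) (p i s) = x s) s :
  (forall i, {for s, continuous (p i)}) ->
  {for s, continuous (fun s => tensor_point (h s))}.
Proof.
move=> cp; apply: continuous_comp; last exact: tensor_class_continuous.
by apply: subset_continuous_at; exact: prod_continuous_at.
Qed.

Lemma tensor_locally_trivial x : exists U phi tau,
  U x /\ is_local_trivialisation tensor_proj tensor_act U phi tau.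
Proof.
pose h0 i := cid (local_section (E i) x); pose U i := projT1 (h0 i).
pose h1 i := cid (projT2 (h0 i)); pose s i := projT1 (h1 i).
pose h2 i := cid (projT2 (h1 i)); pose tau i := projT1 (h2 i).
have h i : local_section_spec x (U i) (s i) (tau i) := projT2 (h2 i).
clearbody tau; clear h2; clearbody s; clear h1; clearbody U; clear h0.
pose V := \bigcap_(i in [set: 'I_n.+1]) U i.
have VU y i : V y -> U i y by move=> /(_ i I).
pose t (u : tensor_total) : U1 :=
  \big[@u1_mul R/u1_one]_i tau i (tcomp (tensor_repr u) i).
have tE p : V (tensor_proj (tensor_class p)) ->
    t (tensor_class p) = \big[@u1_mul R/u1_one]_i tau i (tcomp p i).
  move=> Vp; rewrite /t; have [c [c1 ->]] := tensor_repr_class p.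
  rewrite (eq_bigr (fun i => u1_mul (c i) (tau i (tcomp p i)))) => [|i _].
    by rewrite big_split /= c1 u1_mul1g.
  have [_ _ _ tA] := h i; rewrite tA //.
  by rewrite -tensor_proj_class; exact: VU.
have oV : open V.
  rewrite openE => y Vy.
  suff nV : nbhs y [set z | forall i, U i z].
    by apply: filterS nV => z Vz i _; exact: Vz.
  apply: filter_forall => i; apply: open_nbhs_nbhs; split; last exact: VU.
  by have [[]] := h i.
apply: (@bundle_of_local_sections _ _ tensor_proj tensor_act
  tensor_act_continuous tensor_proj_act x V
  (fun y => tensor_point (fun i => presecP (s i) y)) t).
  by move=> y; exact: tensor_point_proj.
split.
- split => //.
  + by move=> i _; have [[]] := h i.
  + move=> y /set_mem Vy; apply: tensor_point_continuous_at => i.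
    by have [[_ _ cs _] _ _ _] := h i; apply/cs/mem_set/VU.
  + move=> u /set_mem /= Vu; rewrite -(tensor_reprK u).
    apply: tensor_continuous_at; set p := tensor_repr u.
    have Vp : V (tensor_proj (tensor_class p)) by rewrite tensor_reprK.
    apply: (@eq_open_continuous_at _ _
      ((tensor_proj \o tensor_class) @^-1` V) _
      (fun p => \big[@u1_mul R/u1_one]_i tau i (tcomp p i))) => //.
      suff /continuousP : continuous (tensor_proj \o tensor_class) by exact.
      move=> q; apply: continuous_comp; first exact: tensor_class_continuous.
      exact: tensor_proj_continuous.
    apply: u1_prod_continuous_at => i; apply: continuous_comp.
      exact: tcomp_continuous.
    have [[_ _ _ ct] _ _ _] := h i; apply/ct/mem_set => /=.
    by rewrite -tensor_proj_class; exact: VU.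
- move=> y Vy; rewrite tE ?tensor_point_proj //; apply: big1 => i _.
  by have [_ ts _ _] := h i; apply/ts/VU.
- move=> u; rewrite -(tensor_reprK u); set p := tensor_repr u => Vp.
  rewrite tE // -(@tensor_act_class (fun i => tau i (tcomp p i))) //.
  congr tensor_class; apply: tensor_pre_eq => i.
  have [_ _ sK _] := h i; rewrite -[RHS]sK; last first.
    by rewrite -tensor_proj_class; exact: VU.
  by rewrite -tensor_proj_class.
- move=> g u; rewrite -(tensor_reprK u); set p := tensor_repr u => Vp.
  rewrite -(tensor_act_class _ (prod_at0 g)) !tE //; last first.
    by rewrite (tensor_act_class _ (prod_at0 g)) tensor_proj_act.
  rewrite -[X in u1_mul X _](prod_at0 g) -big_split /=; apply: eq_bigr => i _.
  have [_ _ _ tA] := h i; rewrite tA //.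
  by rewrite -tensor_proj_class; exact: VU.
Qed.

Definition tensor : bundle X :=
  @Bundle X tensor_total tensor_proj tensor_act tensor_act_continuous
    tensor_act1 tensor_actM tensor_proj_act tensor_locally_trivial.

End tensor.

End bundles.

Section delta.
Variable R : realType.
Section delta_bundle.
Variables (n : nat) (A B : topologicalType).
Variables (d : 'I_n.+1 -> continuousType A B) (E : bundle R B).

(* d_0^*E (x) d_1^*E^* (x) d_2^*E (x) ... *)
Definition delta : bundle R A :=
  tensor (fun i => dual_if (odd i) (pullback (d i) E)).

(* The point of the fibre over a given by points q_i of E over d_i a. *)
Definition delta_point (a : A) (q : 'I_n.+1 -> total E)
    (h : forall i, bproj E (q i) = d i a) : total delta :=
  @tensor_point R A n (fun i => dual_if (odd i) (pullback (d i) E)) a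
    (fun i => pullback_point (h i)) (fun=> erefl).

Lemma delta_point_proj a q (h : forall i, bproj E (q i) = d i a) :
  bproj delta (delta_point h) = a.
Proof. exact: tensor_point_proj. Qed.

Lemma delta_point_act a q q' (h : forall i, bproj E (q i) = d i a)
    (h' : forall i, bproj E (q' i) = d i a) c :
  (forall i, q' i = bact (c i) (q i)) ->
  delta_point h' =
    bact (\big[@u1_mul R/u1_one]_(i < n.+1) u1_sgn (odd i) (c i)) (delta_point h).
Proof.
move=> qE; apply: (@tensor_point_act _ _ _ _ _ _ _ _ _
  (fun i : 'I_n.+1 => u1_sgn (odd i) (c i))) => // i.
by apply: pullback_eq => //; rewrite /= /dual_act u1_sgn_sgn addbb; exact: qE.
Qed.

Lemma delta_point_eq a a' q q' (h : forall i, bproj E (q i) = d i a)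
    (h' : forall i, bproj E (q' i) = d i a') :
  a = a' -> q =1 q' -> delta_point h = delta_point h'.
Proof.
move=> aa qq; subst a'; rewrite (@delta_point_act _ _ _ h' h (fun=> u1_one)).
  by rewrite big1 ?bact1 // => i _; rewrite u1_sgn1.
by move=> i; rewrite bact1.
Qed.

(* A section of E, continuous or not, induces one of delta E. *)
Definition delta_pre (s : pre_section E) : pre_section delta :=
  PreSection (fun a => delta_point_proj (fun i => presecP s (d i a))).

Lemma delta_pre_continuous (s : bsection E) : continuous (delta_pre s).
Proof.
move=> a; apply: (@tensor_point_continuous_at _ _ _
  (fun i => dual_if (odd i) (pullback (d i) E)) _ id
  (fun i a => pullback_point (presecP s (d i a))) (fun a i => erefl)) => i.
apply: (@pullback_point_continuous_at _ _ _ (d i) E _ id (fun a => s (d i a))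
  (fun a => presecP s (d i a))); first exact: cvg_id.
by apply: continuous_comp; exact: cts_fun.
Qed.

HB.instance Definition _ (s : bsection E) :=
  isContinuous.Build _ _ (delta_pre s) (@delta_pre_continuous s).

Definition delta_section (s : bsection E) : bsection delta :=
  @BSection R A delta (delta_pre s) (presecP (delta_pre s)).

(* u is the class of some tuple of points of E; this is its i-th component. *)
Definition delta_factor (u : total delta) (i : 'I_n.+1) : total E :=
  @pullback_fibre R A B (d i) E
    (tcomp (E := fun i => dual_if (odd i) (pullback (d i) E)) (tensor_repr u) i).

Lemma delta_factorP u i : bproj E (delta_factor u i) = d i (bproj delta u).
Proof.
rewrite /delta_factor pullbackP; congr (d i _).
have := tensor_proj_class (E := fun i => dual_if (odd i) (pullback (d i) E))
  (tensor_repr u) i.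
by rewrite tensor_reprK => e; exact: esym e.
Qed.

Lemma delta_factorK u : delta_point (delta_factorP u) = u.
Proof.
rewrite -[RHS]tensor_reprK; congr tensor_class.
apply: tensor_pre_eq => i; apply: pullback_eq => //=.
have := tensor_proj_class (E := fun i => dual_if (odd i) (pullback (d i) E))
  (tensor_repr u) i.
by rewrite tensor_reprK => e; exact: e.
Qed.

End delta_bundle.

(* d'_i d_j = d'_(j-1) d_i for i < j, with j written as the successor of an
   index. *)
Definition semisimplicial_identity (n : nat) (A B C : topologicalType)
    (d : 'I_n.+2 -> continuousType A B) (d' : 'I_n.+1 -> continuousType B C) :=
  forall i j : 'I_n.+1, (i <= j)%N -> forall a,
    d' i (d (lift ord0 j) a) = d' j (d (widen_ord (leqnSn n.+1) i) a).

Section canonical_trivialisation.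
Variables (n : nat) (A B C : topologicalType).
Variables (d : 'I_n.+2 -> continuousType A B).
Variables (d' : 'I_n.+1 -> continuousType B C) (E : bundle R C).

(* Over a point a the factors of delta (delta E) are the fibres of E at the
   points d'_i (d_j a), each occurring once as E and once as its dual.
   Contracting these pairs identifies the fibre with U(1), and the unit
   corresponds to delta (delta s) at a for any choice s of points in the fibres
   of E.  The result does not depend on s: see canonical_trivialisationE. *)
Definition canonical_trivialisation : pre_section (delta d (delta d' E)) :=
  delta_pre d (delta_pre d' (point_section E)).

Lemma prod_delta_delta (chi : C -> U1 R) a : semisimplicial_identity d d' ->
  \big[@u1_mul R/u1_one]_(j < n.+2) u1_sgn (odd j)
    (\big[@u1_mul R/u1_one]_(i < n.+1) u1_sgn (odd i) (chi (d' i (d j a)))) = u1_one.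
Proof.
move=> ss.
under eq_bigr do rewrite u1_sgn_prod.
rewrite exchange_big /=.
have -> : \big[@u1_mul R/u1_one]_(i < n.+1) \big[@u1_mul R/u1_one]_(j < n.+2)
    u1_sgn (odd j) (u1_sgn (odd i) (chi (d' i (d j a)))) =
  \big[@u1_mul R/u1_one]_(i < n.+1) u1_mul
    (\big[@u1_mul R/u1_one]_(j < n.+1 | (i <= j)%N)
       u1_sgn (~~ odd (i + j)) (chi (d' j (d (widen_ord (leqnSn n.+1) i) a))))
    (\big[@u1_mul R/u1_one]_(j < n.+1 | (j <= i)%N)
       u1_sgn (odd (i + j)) (chi (d' i (d (widen_ord (leqnSn n.+1) j) a)))).
  apply: eq_bigr => i _; rewrite (bigID (fun j : 'I__ => (i < j)%N)) /=.
  congr u1_mul.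
    rewrite big_mkcond big_ord_recl /= u1_mul1g -big_mkcond /=.
    apply: eq_big => [j|j ij]; first by rewrite /bump /= add1n ltnS.
    rewrite ss // ?u1_sgn_sgn add0n oddD.
    by case: (odd i); case: (odd j).
  rewrite big_mkcond big_ord_recr /= ltn_ord /= u1_mulg1 -big_mkcond /=.
  apply: eq_big => [j|j ij]; first by rewrite -leqNgt.
  by rewrite u1_sgn_sgn oddD addbC.
rewrite big_split /= [X in u1_mul _ X](exchange_big_dep predT) //= -big_split /=.
apply: big1 => i _; rewrite -big_split /=; apply: big1 => j _.
by rewrite addnC u1_mulC u1_sgnV.
Qed.

Lemma canonical_trivialisationE (s : pre_section E) :
  semisimplicial_identity d d' ->
  delta_pre d (delta_pre d' s) =1 canonical_trivialisation.
Proof.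
move=> ss a.
have /choice[chi sE] : forall c, exists g, s c = bact g (point_section E c).
  by move=> c; apply: bact_transitive; rewrite !presecP.
rewrite /canonical_trivialisation /=.
rewrite (@delta_point_act _ _ _ d _ a _ _ (fun j => presecP
  (delta_pre d' (point_section E)) (d j a)) _ (fun j =>
  \big[@u1_mul R/u1_one]_(i < n.+1) u1_sgn (odd i) (chi (d' i (d j a))))).
  by rewrite prod_delta_delta // bact1.
move=> j /=; apply: delta_point_act => i; exact: sE.
Qed.

End canonical_trivialisation.

Section exchange.
Variables (m n : nat) (A Bh Bv C : topologicalType).
Variables (dh : 'I_m.+1 -> continuousType A Bh).
Variables (dv' : 'I_n.+1 -> continuousType Bh C).
Variables (dv : 'I_n.+1 -> continuousType A Bv).
Variables (dh' : 'I_m.+1 -> continuousType Bv C).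
Hypothesis comm : forall j i a, dv' j (dh i a) = dh' i (dv j a).
Variable E : bundle R C.

(* The canonical isomorphism from delta_h (delta_v E) to delta_v (delta_h E):
   it reorders the tensor factors.  Its definition picks representing tuples;
   delta_exchange_point shows that the choice is irrelevant. *)
Lemma delta_exchange_subproof (u : total (delta dh (delta dv' E))) j i :
  bproj E (delta_factor (delta_factor u i) j) =
  dh' i (dv j (bproj (delta dh (delta dv' E)) u)).
Proof. by rewrite !delta_factorP comm. Qed.

Definition delta_exchange (u : total (delta dh (delta dv' E))) :
    total (delta dv (delta dh' E)) :=
  delta_point (fun j => delta_point_proj (delta_exchange_subproof u j)).

Lemma delta_exchange_point a (p : 'I_m.+1 -> 'I_n.+1 -> total E)
    (h : forall i j, bproj E (p i j) = dv' j (dh i a))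
    (h' : forall j i, bproj E (p i j) = dh' i (dv j a)) :
  delta_exchange (delta_point (fun i => delta_point_proj (h i))) =
  delta_point (fun j => delta_point_proj (h' j)).
Proof.
set u := delta_point (fun i => _).
have ua : bproj (delta dh (delta dv' E)) u = a by exact: delta_point_proj.
have /choice[c cE] i : exists g,
    delta_factor u i = bact g (delta_point (h i)).
  by apply: bact_transitive; rewrite delta_point_proj delta_factorP ua.
have c1 : \big[@u1_mul R/u1_one]_(i < m.+1) u1_sgn (odd i) (c i) = u1_one.
  apply: (bact_free (p := u)); rewrite bact1.
  have ha i : bproj (delta dv' E) (delta_factor u i) = dh i a.
    by rewrite delta_factorP ua.
  rewrite -(@delta_point_act _ _ _ dh _ a _ _ (fun i => delta_point_proj (h i)) ha) //.
  by rewrite -[RHS]delta_factorK; exact: delta_point_eq.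
have /choice[b bE] (ij : 'I_m.+1 * 'I_n.+1) : exists g,
    delta_factor (delta_factor u ij.1) ij.2 = bact g (p ij.1 ij.2).
  by apply: bact_transitive; rewrite h !delta_factorP ua.
have bc i : \big[@u1_mul R/u1_one]_(j < n.+1) u1_sgn (odd j) (b (i, j)) = c i.
  apply: (bact_free (p := delta_point (h i))); rewrite -cE.
  have hi j : bproj E (delta_factor (delta_factor u i) j) = dv' j (dh i a).
    by rewrite !delta_factorP ua.
  rewrite -(@delta_point_act _ _ _ _ _ _ _ _ (h i) hi); last first.
    by move=> j; exact: (bE (i, j)).
  rewrite -[RHS]delta_factorK; apply: delta_point_eq => //.
  by rewrite delta_factorP ua.
have H1 j i : bproj E (delta_factor (delta_factor u i) j) = dh' i (dv j a).
  by rewrite !delta_factorP ua comm.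
transitivity (delta_point (fun j => delta_point_proj (H1 j))).
  apply: delta_point_eq => // j; apply: delta_point_eq => //.
  by congr (dv j _).
rewrite (@delta_point_act _ _ _ dv _ a _ _ (fun j => delta_point_proj (h' j))
  (fun j => delta_point_proj (H1 j))
  (fun j => \big[@u1_mul R/u1_one]_(i < m.+1) u1_sgn (odd i) (b (i, j)))).
  rewrite (_ : \big[_/_]_(_ < _) _ = u1_one) ?bact1 // -[RHS]c1.
  under eq_bigr do rewrite u1_sgn_prod.
  rewrite exchange_big /=; apply: eq_bigr => i _; rewrite -bc u1_sgn_prod.
  apply: eq_bigr => j _; by rewrite !u1_sgn_sgn addbC.
move=> j; apply: delta_point_act => i; exact: (bE (i, j)).
Qed.

End exchange.

End delta.

Definition is_cover (X Y : topologicalType) (p : Y -> X) :=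
  continuous p /\
  forall x, exists (U : set X) (s : X -> Y),
    [/\ open U, U x, {in U, continuous s} & forall y, U y -> p (s y) = y].

Section fibre_power_maps.

HB.instance Definition _ k (Y X : cghType) (p : continuousType Y X) (i : 'I_k) :=
  isContinuous.Build _ _ (@fibre_proj k Y X p i) (@fibre_proj_continuous k Y X p i).

Section omit.
Variables (k : nat) (Y X : cghType) (p : continuousType Y X) (i : 'I_k.+1).

Lemma omit_subproof (j j' : 'I_k) (y : fibre_power k.+1 p) :
  p (fibre_proj (lift i j) y) = p (fibre_proj (lift i j') y).
Proof. exact: fibre_projP. Qed.

(* The face map Y^[k+1] -> Y^[k] omitting the factor numbered i (from 0). *)
Definition omit : continuousType (fibre_power k.+1 p) (fibre_power k p) :=
  fibre_tuple omit_subproof.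
End omit.

Lemma omit_semisimplicial k (Y X : cghType) (p : continuousType Y X) :
  semisimplicial_identity (@omit k.+1 Y X p) (@omit k Y X p).
Proof.
move=> i j ij y; apply: fibre_power_eq => l.
change (fibre_proj (lift (lift ord0 j) (lift i l)) y =
        fibre_proj (lift (widen_ord (leqnSn k.+1) i) (lift j l)) y).
congr fibre_proj; apply: val_inj => /=; rewrite /bump /=.
by move: ij; case: (leqP i l); case: (leqP j l); lia.
Qed.

Section fibre_map.
Variables (W Y W' Y' : cghType) (p : continuousType W Y).
Variables (p' : continuousType W' Y') (q : continuousType W W').
Variable b : continuousType Y Y'.
Hypothesis comm : forall w, p' (q w) = b (p w).
Variable k : nat.

Lemma fibre_map_subproof (i j : 'I_k) (w : fibre_power k p) :
  p' ((q \o fibre_proj i) w) = p' ((q \o fibre_proj j) w).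
Proof. by rewrite /= !comm (fibre_projP i j). Qed.

Definition fibre_map : continuousType (fibre_power k p) (fibre_power k p') :=
  fibre_tuple (f := fun i => q \o fibre_proj i) fibre_map_subproof.
End fibre_map.

Lemma fibre_map_omit (W Y W' Y' : cghType) (p : continuousType W Y)
    (p' : continuousType W' Y') (q : continuousType W W')
    (b : continuousType Y Y') (comm : forall w, p' (q w) = b (p w)) k i w :
  fibre_map comm k (omit p i w) = omit p' i (fibre_map comm k.+1 w).
Proof. exact: fibre_power_eq. Qed.

End fibre_power_maps.
Arguments omit {k Y X} p i.

(* 3-truncated semisimplicial spaces. *)
Record semisimplicial3 := Semisimplicial3 {
  ss0 : cghType ; ss1 : cghType ; ss2 : cghType ; ss3 : cghType ;
  ssd1 : 'I_2 -> continuousType ss1 ss0 ;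
  ssd2 : 'I_3 -> continuousType ss2 ss1 ;
  ssd3 : 'I_4 -> continuousType ss3 ss2 ;
  ss_identity2 : semisimplicial_identity ssd2 ssd1 ;
  ss_identity3 : semisimplicial_identity ssd3 ssd2 }.

Record semisimplicial3_map (Z T : semisimplicial3) := Semisimplicial3Map {
  ssm0 : continuousType (ss0 Z) (ss0 T) ;
  ssm1 : continuousType (ss1 Z) (ss1 T) ;
  ssm2 : continuousType (ss2 Z) (ss2 T) ;
  ssm3 : continuousType (ss3 Z) (ss3 T) ;
  ssm_face1 : forall i z, ssm0 (ssd1 Z i z) = ssd1 T i (ssm1 z) ;
  ssm_face2 : forall i z, ssm1 (ssd2 Z i z) = ssd2 T i (ssm2 z) ;
  ssm_face3 : forall i z, ssm2 (ssd3 Z i z) = ssd3 T i (ssm3 z) }.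

(* Y^[n+1] for n <= 3. *)
Definition cech3 (Y X : cghType) (p : continuousType Y X) : semisimplicial3 :=
  @Semisimplicial3 (fibre_power 1 p) (fibre_power 2 p) (fibre_power 3 p)
    (fibre_power 4 p) (omit p) (omit p) (omit p)
    (@omit_semisimplicial 1 Y X p) (@omit_semisimplicial 2 Y X p).

Definition cech3_map (W Y W' Y' : cghType) (p : continuousType W Y)
    (p' : continuousType W' Y') (q : continuousType W W')
    (b : continuousType Y Y') (comm : forall w, p' (q w) = b (p w)) :
    semisimplicial3_map (cech3 p) (cech3 p') :=
  @Semisimplicial3Map (cech3 p) (cech3 p') (fibre_map comm 1) (fibre_map comm 2)
    (fibre_map comm 3) (fibre_map comm 4) (fibre_map_omit comm (k := 1))
    (fibre_map_omit comm (k := 2)) (fibre_map_omit comm (k := 3)).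

Section gerbes.
Variable R : realType.

Definition is_bundle_gerbe (Y X : cghType) (p : continuousType Y X)
    (E : bundle R (fibre_power 2 p)) (m : bsection (delta (omit p) E)) :=
  is_cover p /\
  forall y : fibre_power 4 p,
    delta_section (omit p) m y = canonical_trivialisation (omit p) (omit p) E y.

Section vertical_powers.
Variables (Z T : semisimplicial3) (f : semisimplicial3_map Z T) (k : nat).

(* Z_n^[k] -> Z_(n-1)^[k] over T_n -> T_(n-1) *)
Definition hface2 (i : 'I_3) :
    continuousType (fibre_power k (ssm2 f)) (fibre_power k (ssm1 f)) :=
  fibre_map (ssm_face2 f i) k.

Definition hface3 (i : 'I_4) :
    continuousType (fibre_power k (ssm3 f)) (fibre_power k (ssm2 f)) :=
  fibre_map (ssm_face3 f i) k.
End vertical_powers.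

Record rigid_data (X : cghType) := RigidData {
  rg_Y : cghType ;
  rg_pi : continuousType rg_Y X ;
  rg_Z : semisimplicial3 ;
  rg_f : semisimplicial3_map rg_Z (cech3 rg_pi) ;
  rg_E : bundle R (fibre_power 2 (ssm1 rg_f)) ;
  rg_m : bsection (delta (omit (ssm1 rg_f)) rg_E) ;
  rg_M : bsection (delta (hface2 rg_f 2) rg_E) }.

Lemma hface_semisimplicial (Z T : semisimplicial3)
    (f : semisimplicial3_map Z T) k :
  semisimplicial_identity (hface3 f k) (hface2 f k).
Proof.
by move=> i j ij z; apply: fibre_power_eq => l; exact: (@ss_identity3 Z).
Qed.

Lemma hface2_omit (Z T : semisimplicial3) (f : semisimplicial3_map Z T)
    (j i : 'I_3) (z : fibre_power 3 (ssm2 f)) :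
  omit (ssm1 f) j (hface2 f 3 i z) = hface2 f 2 i (omit (ssm2 f) j z).
Proof. exact/esym/fibre_map_omit. Qed.

(* The equation between delta_v M and delta_h m compares sections of the
   canonically isomorphic bundles delta_v (delta_h E), delta_h (delta_v E). *)
Record is_rigid (X : cghType) (G : rigid_data X) := IsRigid {
  rg_cover : is_cover (rg_pi G) ;
  rg_cover0 : is_cover (ssm0 (rg_f G)) ;
  rg_cover1 : is_cover (ssm1 (rg_f G)) ;
  rg_cover2 : is_cover (ssm2 (rg_f G)) ;
  rg_cover3 : is_cover (ssm3 (rg_f G)) ;
  rg_gerbe : is_bundle_gerbe (rg_m G) ;
  rg_vM : forall z : fibre_power 3 (ssm2 (rg_f G)),
    delta_exchange (hface2_omit (f := rg_f G))
      (delta_section (hface2 (rg_f G) 3) (rg_m G) z) =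
    delta_section (omit (ssm2 (rg_f G))) (rg_M G) z ;
  rg_hM : forall z : fibre_power 2 (ssm3 (rg_f G)),
    delta_section (hface3 (rg_f G) 2) (rg_M G) z =
    canonical_trivialisation (hface3 (rg_f G) 2) (hface2 (rg_f G) 2) (rg_E G) z }.

Record rigid_bundle_2gerbe (X : cghType) := RigidBundle2Gerbe {
  rg_data :> rigid_data X ;
  rg_rigid : is_rigid rg_data }.

Section square.
Variables (X W Y1 Y2 : cghType).
Variables (p1 : continuousType Y1 X) (p2 : continuousType Y2 X).
Variables (q1 : continuousType W Y1) (q2 : continuousType W Y2).
Hypothesis comm : forall w, p1 (q1 w) = p2 (q2 w).

Definition square_corner (w : W) : fibre_product p1 p2 :=
  @set_elt _ (fibre_product_set p1 p2) (q1 w, q2 w) (comm w).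

Definition locally_split :=
  [/\ is_cover p1, is_cover p2, is_cover q1, is_cover q2 &
      is_cover square_corner].

(* W^[k,1] -> Y1^[k] *)
Definition wcol k : continuousType (fibre_power k q2) (fibre_power k p1) :=
  fibre_map comm k.

(* W^[k,l]: the l-fold fibre product of W^[k,1] over Y1^[k]. *)
Definition wpower k l : cghType := fibre_power l (wcol k).

Definition wface_h k l (i : 'I_k.+1) :
    continuousType (wpower k.+1 l) (wpower k l) :=
  fibre_map (fibre_map_omit comm i) l.

Definition wface_v k l (j : 'I_l.+1) :
    continuousType (wpower k l.+1) (wpower k l) :=
  omit (wcol k) j.

Lemma wface_vh k l j i (w : wpower k.+1 l.+1) :
  @wface_v k l j (@wface_h k l.+1 i w) = @wface_h k l i (@wface_v k.+1 l j w).
Proof. exact/esym/fibre_map_omit. Qed.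

Lemma wface_h_semisimplicial k l :
  semisimplicial_identity (@wface_h k.+1 l) (@wface_h k l).
Proof.
move=> i j ij w; apply: fibre_power_eq => m; exact: omit_semisimplicial.
Qed.

End square.
Arguments wpower {X W Y1 Y2 p1 p2 q1 q2} comm k l.
Arguments wface_h {X W Y1 Y2 p1 p2 q1 q2} comm k l i.
Arguments wface_v {X W Y1 Y2 p1 p2 q1 q2} comm k l j.
Arguments wface_vh {X W Y1 Y2 p1 p2 q1 q2} comm k l j i w.

Record bigerbe (X : cghType) := Bigerbe {
  bg_W : cghType ; bg_Y1 : cghType ; bg_Y2 : cghType ;
  bg_p1 : continuousType bg_Y1 X ;
  bg_p2 : continuousType bg_Y2 X ;
  bg_q1 : continuousType bg_W bg_Y1 ;
  bg_q2 : continuousType bg_W bg_Y2 ;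
  bg_comm : forall w, bg_p1 (bg_q1 w) = bg_p2 (bg_q2 w) ;
  bg_split : locally_split bg_comm ;
  bg_E : bundle R (wpower bg_comm 2 2) ;
  bg_M : bsection (delta (wface_h bg_comm 2 2) bg_E) ;
  bg_s : bsection (delta (wface_v bg_comm 2 2) bg_E) ;
  bg_hM : forall w : wpower bg_comm 4 2,
    delta_section (wface_h bg_comm 3 2) bg_M w =
    canonical_trivialisation (wface_h bg_comm 3 2) (wface_h bg_comm 2 2) bg_E w ;
  bg_vs : forall w : wpower bg_comm 2 4,
    delta_section (wface_v bg_comm 2 3) bg_s w =
    canonical_trivialisation (wface_v bg_comm 2 3) (wface_v bg_comm 2 2) bg_E w ;
  bg_vM_hs : forall w : wpower bg_comm 3 3,
    delta_exchange (wface_vh bg_comm 2 2)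
      (delta_section (wface_h bg_comm 2 3) bg_s w) =
    delta_section (wface_v bg_comm 3 2) bg_M w }.

End gerbes.
Arguments bg_comm {R X} b w : rename.

(* Main.v *)
Require Import Defs.
From mathcomp Require Import all_boot all_classical all_reals topology.

(** The algebraic axioms of a rigid bundle 2-gerbe for these data are, face map
by face map, the axioms of the bigerbe: the vertical and horizontal face maps
of the semisimplicial space W^[n+1,1] over Y1^[n+1] are those of the spaces
W^[k,l].  The equation between delta_v M and delta_h s moreover involves a
proof that the two kinds of face maps commute, on which the canonical
isomorphism does not depend (delta_exchange_irrelevance).

The content is that W^[k,1] -> Y1^[k] is a cover for every k >= 1 (wcol_cover).
Let (y_0, ..., y_(k-1)) be a point of Y1^[k] over x in X.  A local section t
of Y2 -> X around x gives points (y_i, t(x)) of the fibre product of Y1 and Y2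
over X, and local sections of the corner map W -> Y1 x_X Y2 around these points
give w_i in W over them.  All w_i lie over the same point t(x) of Y2, so they
form a point of W^[k,1]; it depends continuously on the y_i near the given
point.

In compactly generated spaces, the fibre products carry a finer topology than
the subspace topology of the product, so a map defined on an open subset U of
a space S needs an argument to be continuous into them: U is again compactly
generated, because compact Hausdorff spaces are regular
(continuous_into_kification_in). *)

Local Open Scope classical_set_scope.

(** Regularity of the compact Hausdorff space K, stated in the ambient space:
for each y in K outside U, the points z and y have disjoint neighbourhoods, and
compactness of K \ U makes one neighbourhood of z serve for all y. *)
Lemma compact_nbhs_regular {S : topologicalType} {K U : set S} {z : S} :
  hausdorff_space S -> compact K -> open U -> U z ->
  exists2 A : set S, nbhs z A & closure A `&` K `<=` U.
Proof.
move=> hS cK oU Uz.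
have /compact_near_coveringP cKU : compact (K `&` ~` U).
  by apply: compact_closedI => //; exact: open_closedC.
have Fz : Filter (powerset_filter_from (nbhs z)).
  exact: powerset_filter_from_filter.
have sep y : (K `&` ~` U) y -> \forall y' \near y &
    A \near powerset_filter_from (nbhs z), ~ closure A y'.
  move=> [_ nUy].
  have zy : z != y by apply/eqP => zy; apply: nUy; rewrite -zy.
  move: hS; rewrite open_hausdorff => /(_ _ _ zy)[[A0 B0] /= [+ +] [oA oB AB]].
  rewrite !inE => Az By.
  exists (B0, [set A | A `<=` A0]) => /=.
    split; first exact: open_nbhs_nbhs.
    exact/small_set_sub/open_nbhs_nbhs.
  move=> [y' A] /= [By' AA0] /(_ B0 (open_nbhs_nbhs (conj oB By')))[w [Aw Bw]].
  have : set0 w by rewrite -(eqP AB); split => //; exact: AA0.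
  by [].
have [Q /= [QF _ [A QA]] QKU] := cKU _ _ _ Fz sep.
exists A; first exact: QF.
move=> y [clA Ky]; apply: contrapT => nUy.
exact: (QKU A QA y (conj Ky nUy)).
Qed.

(** The relative form of continuous_into_kification.  A k-open set O of T is
only controlled on compact sets, and the image under f of a compact set K is
compact only as long as K stays inside U.  So openness in K is checked near
each point z separately, on a compact neighbourhood of z in K that lies in U. *)
Lemma continuous_into_kification_in {S : cghType} {T : topologicalType}
    {U : set S} {f : S -> T} :
  open U -> {in U, continuous f} -> {in U, continuous (f : S -> kification T)}.
Proof.
move=> oU cf x xU N; rewrite nbhsE => -[O [oO Ox] ON].
suff oW : open (U `&` f @^-1` O).
  apply: filterS (open_nbhs_nbhs (conj oW (conj (set_mem xU) Ox))).
  by move=> y [_ /ON].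
apply: cgh_cg => K cK.
(* The largest open set whose trace on K lies in U and f^-1(O). *)
exists (\bigcup_(V in [set V : set S | open V /\
  V `&` K `<=` U `&` f @^-1` O]) V).
  by apply: bigcup_open => V [].
apply/seteqP; split => [z [[Uz Oz] Kz]|z [[V [_ VK] Vz] Kz]]; last first.
  by split => //; exact: VK.
split => //.
have [A zA AU] := compact_nbhs_regular (@cgh_hausdorff S) cK oU Uz.
have cC : compact (closure A `&` K).
  by rewrite setIC; apply: compact_closedI => //; exact: closed_closure.
have cfC : {within closure A `&` K, continuous f}.
  by apply: continuous_in_subspaceT => y yC; apply/cf/mem_set/AU/set_mem.
have [G oG GC] := (oO : kopen (O : set T)) _ (continuous_compact cfC cC).
have Gz : G (f z).
  have : (G `&` f @` (closure A `&` K)) (f z); last by case.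
  rewrite -GC; split => //; exists z => //; split => //.
  exact/subset_closure/(nbhs_singleton zA).
exists (interior (A `&` f @^-1` G)); last first.
  by apply: filterI => //; apply: (cf z (mem_set Uz)); exact: open_nbhs_nbhs.
split; first exact: open_interior.
move=> y [/interior_subset[Ay Gy] Ky].
have Cy : (closure A `&` K) y by split => //; exact: subset_closure.
split; first exact: AU.
have : (O `&` f @` (closure A `&` K)) (f y); last by case.
by rewrite GC; split => //; exists y.
Qed.

(** Local sections are total functions here, so a map with values in A on U has
to be extended to S; its value at x serves as default where it leaves A. *)
Lemma local_lift_kified_subset {S : cghType} {T : topologicalType}
    {A : set T} (hT : hausdorff_space T) {U : set S} {g : S -> T} {x : S} :
  open U -> U x -> {in U, continuous g} -> (forall y, U y -> A (g y)) ->
  exists2 f : S -> kified_subset A hT,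
    {in U, continuous f} & forall y, U y -> set_val (f y) = g y.
Proof.
move=> oU Ux cg gA.
pose f y : A := if pselect (A (g y)) is left Ay then set_elt Ay
                else set_elt (gA x Ux).
have fE y : U y -> set_val (f y) = g y.
  by move=> Uy; rewrite /f; case: pselect => // -[]; exact: (gA y Uy).
exists f => //; apply: continuous_into_kification_in => // y yU.
apply: subset_continuous_at.
apply: (eq_open_continuous_at (g := g) oU (set_mem yU)) => //; exact: cg.
Qed.

(** The local section is y |-> (s_i (y_i, t (p1 y_0)))_i for a local section t
of p2 and local sections s_i of the corner map.  At least one factor is required,
to read off the base point p1 y_0 where t is evaluated. *)
Lemma wcol_cover {X W Y1 Y2 : cghType} {p1 : continuousType Y1 X}
    {p2 : continuousType Y2 X} {q1 : continuousType W Y1}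
    {q2 : continuousType W Y2} {comm : forall w, p1 (q1 w) = p2 (q2 w)} k :
  is_cover p2 -> is_cover (square_corner comm) -> is_cover (wcol comm k.+1).
Proof.
move=> [_ p2s] [_ cs]; split; first exact: cts_fun.
move=> y0.
have [V [t [oV Vx ct tE]]] := p2s (p1 (fibre_proj ord0 y0)).
pose a (y : fibre_power k.+1 p1) := p1 (fibre_proj ord0 y).
have ca : continuous a.
  move=> y; apply: (continuous_comp (f := fibre_proj ord0)).
    exact: fibre_proj_continuous.
  exact: cts_fun.
pose U0 := a @^-1` V.
have oU0 : open U0 by apply: open_comp => // y _; exact: ca.
have g_cont i : {in U0, continuous (fun y => (fibre_proj i y, t (a y)))}.
  move=> y /set_mem U0y; apply: pair_continuous_at.
    exact: fibre_proj_continuous.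
  by apply: continuous_comp; [exact: ca | apply/ct/mem_set].
have g_fibre i y : U0 y -> fibre_product_set p1 p2 (fibre_proj i y, t (a y)).
  by move=> U0y; rewrite /fibre_product_set /= tE // (fibre_projP i ord0).
have /choice[f fP] i : exists f : fibre_power k.+1 p1 -> fibre_product p1 p2,
    {in U0, continuous f} /\
    forall y, U0 y -> set_val (f y) = (fibre_proj i y, t (a y)).
  have [f ? ?] := local_lift_kified_subset
    (hausdorff_prod (@cgh_hausdorff Y1) (@cgh_hausdorff Y2)) oU0 Vx
    (g_cont i) (g_fibre i).
  by exists f.
have /choice[Us csP] i : exists Us :
      set (fibre_product p1 p2) * (fibre_product p1 p2 -> W),
    [/\ open Us.1, Us.1 (f i y0), {in Us.1, continuous Us.2} &
      forall c, Us.1 c -> square_corner comm (Us.2 c) = c].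
  by have [U [s ?]] := cs (f i y0); exists (U, s).
have near_Us i : \forall y \near y0, (Us i).1 (f i y).
  have [oUs Usy0 _ _] := csP i.
  exact: ((fP i).1 y0 (mem_set Vx) _ (open_nbhs_nbhs (conj oUs Usy0))).
pose U1 : set (fibre_power k.+1 p1) :=
  interior (U0 `&` [set y | forall i, (Us i).1 (f i y)]).
have U1y0 : U1 y0.
  apply: filterI; first exact: open_nbhs_nbhs.
  exact: filter_forall near_Us.
have U1U0 y : U1 y -> U0 y by move=> /interior_subset[].
have U1Us y i : U1 y -> (Us i).1 (f i y) by move=> /interior_subset[_]; exact.
pose h (y : fibre_power k.+1 p1) : prod_topology (fun _ : 'I_k.+1 => W) :=
  fun i => (Us i).2 (f i y).
have h_corner i y : U1 y -> q1 (h y i) = fibre_proj i y /\ q2 (h y i) = t (a y).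
  move=> U1y; have [_ _ _ /(_ _ (U1Us y i U1y))] := csP i.
  by move=> /(congr1 set_val); rewrite (fP i).2; [case | exact: U1U0].
have h_cont : {in U1, continuous h}.
  move=> y /set_mem U1y; apply: prod_continuous_at => i.
  apply: (continuous_comp (f := f i)).
    by apply: (fP i).1; apply/mem_set/U1U0.
  by have [_ _ c _] := csP i; apply/c/mem_set/U1Us.
have h_fibre y : U1 y -> fibre_power_set q2 (h y).
  by move=> U1y i j; rewrite (h_corner i y U1y).2 (h_corner j y U1y).2.
have [s cts sE] := local_lift_kified_subset
  (hausdorff_product (fun _ : 'I_k.+1 => @cgh_hausdorff W))
  (open_interior _) U1y0 h_cont h_fibre.
exists U1, s; split => //; first exact: open_interior.
move=> y U1y; apply: fibre_power_eq => i.
by rewrite -(h_corner i y U1y).1 -sE.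
Qed.

(** The rigid 2-gerbe and the bigerbe refer to different opaque proofs that the
horizontal and vertical face maps commute. *)
Lemma delta_exchange_irrelevance (R : realType) (m n : nat)
    (A Bh Bv C : topologicalType) (dh : 'I_m.+1 -> continuousType A Bh)
    (dv' : 'I_n.+1 -> continuousType Bh C) (dv : 'I_n.+1 -> continuousType A Bv)
    (dh' : 'I_m.+1 -> continuousType Bv C)
    (H H' : forall j i a, dv' j (dh i a) = dh' i (dv j a)) (E : bundle R C) u :
  delta_exchange H (E := E) u = delta_exchange H' u.
Proof. by rewrite (Prop_irrelevance H H'). Qed.

Theorem propositionB2 (R : realType) (X : cghType) (B : bigerbe R X) :
  exists G : rigid_bundle_2gerbe R X,
    rg_data G =
      {| rg_Y := bg_Y1 B ;
         rg_pi := bg_p1 B ;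
         rg_Z := cech3 (bg_q2 B) ;
         rg_f := cech3_map (bg_comm B) ;
         rg_E := bg_E B ;
         rg_m := bg_s B ;
         rg_M := bg_M B |}.
Proof.
have [cp1 cp2 _ _ cc] := bg_split B.
have cw k := wcol_cover k cp2 cc.
match goal with |- exists G, _ = ?D =>
  suff rD : is_rigid D by exists (RigidBundle2Gerbe rD)
end.
split.
- exact: cp1.
- exact: (cw 0%N).
- exact: (cw 1%N).
- exact: (cw 2%N).
- exact: (cw 3%N).
- by split; [exact: (cw 1%N) | move=> w; exact: bg_vs].
- move=> w; apply: etrans (bg_vM_hs w).
  exact: delta_exchange_irrelevance.
- by move=> w; exact: bg_hM.
Qed.
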